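(* Let $r\ge2$, $\bm{\mu}=(\mu_1,\dots,\mu_r)\in\mathcal{L}^r$ with $\mu_j\in\mathcal{L}_{N_j}$, $N_j\le\infty$, and $\mu_r\in\mathcal{L}_m$ with $m=N_r<\infty$. Let $\bm{\nu}=(\mu_1,\dots,\mu_{r-1})$, $\bm{K}=(N_1,\dots,N_{r-1})$, let $\Phi$ be the monic orthogonal polynomial of degree $m$ of $\mu_r$, and $\widehat{\bm{\nu}}=(\Phi\mu_1,\dots,\Phi\mu_{r-1})$. Let $a_{\bm{n},j},b_{\bm{n},j}$ be the nearest neighbour recurrence coefficients of $\bm{\mu}$ and $\widehat a_{\bm{k},j},\widehat b_{\bm{k},j}$ those of $\widehat{\bm{\nu}}$. Then: (i) $a_{(\bm{k},m),r}=0$ for all $\bm{k}\in\mathbb{N}^{r-1}_{\bm{K}}$ (for which this coefficient is defined). (ii) Suppose additionally that $\bm{\nu}$ and $\widehat{\bm{\nu}}$ are perfect. Then for each $j=1,\dots,r-1$, $$a_{(\bm{k},m),j}=\widehat a_{\bm{k},j}\quad(\bm{k}\in\mathbb{N}^{r-1}_{\bm{K}}),\qquad b_{(\bm{k},m),j}=\widehat b_{\bm{k},j}\quad(\bm{k}\in\mathbb{N}^{r-1}_{\bm{K}-\bm{e}_j}).$$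
   Context: $\mathbb{N}=\{0,1,2,\dots\}$; $\bm{e}_j$ are the standard unit vectors. A moment functional is a linear map $\mu:\mathbb{C}[x]\to\mathbb{C}$; put $\Delta_n=\det(\mu[x^{i+k}])_{i,k=0}^{n-1}$. For $N\in\{1,2,\dots\}$, $\mathcal{L}_N$ is the set of $\mu$ with $\Delta_n\ne0$ for $1\le n\le N$ and $\Delta_n=0$ for $n>N$; $\mathcal{L}_\infty$ is the set of $\mu$ with $\Delta_n\neq0$ for all $n$; $\mathcal{L}=\mathcal{L}_\infty\cup\bigcup_{N\ge1}\mathcal{L}_N$. The monic orthogonal polynomial of degree $m$ of $\mu\in\mathcal{L}_m$ is the unique monic $P$ of degree $m$ with $\mu[P(x)x^p]=0$, $0\le p\le m-1$. $\Phi\mu$ denotes the functional $f\mapsto\mu[\Phi f]$. For a system $(\mu_1,\dots,\mu_s)$ of moment functionals and $\bm{n}\in\mathbb{N}^s$, $|\bm{n}|=n_1+\dots+n_s$, a type II multiple orthogonal polynomial at $\bm{n}$ is a nonzero polynomial $P$ with $\deg P\le|\bm{n}|$ and $\mu_j[P(x)x^p]=0$ for $0\le p\le n_j-1$, $1\le j\le s$. The index $\bm{n}$ is normal if every such $P$ has degree exactly $|\bm{n}|$; then $P_{\bm{n}}$ denotes the unique monic one. Nearest neighbour recurrence: if $\bm{n}$ and $\bm{n}+\bm{e}_j$ are normal, then $xP_{\bm{n}}=P_{\bm{n}+\bm{e}_j}+b_{\bm{n},j}P_{\bm{n}}+\sum_{i=1}^s a_{\bm{n},i}P_{\bm{n}-\bm{e}_i}$,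 where $a_{\bm{n},i}=0$ if $n_i=0$ (if $\bm{n}-\bm{e}_i$ is not normal, $P_{\bm{n}-\bm{e}_i}$ is any choice of type II polynomial at $\bm{n}-\bm{e}_i$). Thus $b_{\bm{n},j}$ is defined when $\bm{n},\bm{n}+\bm{e}_j$ are normal, and $a_{\bm{n},i}$ is defined when $\bm{n}$ and some $\bm{n}+\bm{e}_l$ are normal; for $n_i>0$, $a_{\bm{n},i}=\mu_i[P_{\bm{n}}x^{n_i}]/\mu_i[P_{\bm{n}-\bm{e}_i}x^{n_i-1}]$, independently of $j$. For $\bm{M}\in(\mathbb{N}\cup\{\infty\})^s$, $\mathbb{N}^s_{\bm{M}}=\{\bm{n}\in\mathbb{N}^s: n_j\le M_j\ \forall j\}$. The systems $\bm{\nu}$ and $\widehat{\bm{\nu}}$ are called perfect if all indices in $\mathbb{N}^{r-1}_{\bm{K}}$ are normal for them. Convention: if all $N_j$ are finite, the coefficients $a_{\bm{N},j}$ ($\bm{N}=(N_1,\dots,N_r)$) for $\bm{\mu}$ and $\widehat a_{\bm{K},j}$ for $\widehat{\bm{\nu}}$ are set to be $0$. Also, $(\bm{k},m)$ is normal for $\bm{\mu}$ if and only if $\bm{k}$ is normal for $\widehat{\bm{\nu}}$. *)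

(* Defs.v *)
From HB Require Import structures.
From mathcomp Require Export all_boot all_order all_algebra.
From mathcomp Require Export reals.
From mathcomp Require Export complex.

Set Implicit Arguments.
Unset Strict Implicit.
Unset Printing Implicit Defensive.

Import GRing.Theory.
Local Open Scope ring_scope.

Definition index (s : nat) := {ffun 'I_s -> nat}.

Section Index.
Local Open Scope nat_scope.
Variable s : nat.
Implicit Types (n : index s) (j : 'I_s).

Definition norm1 n : nat := \sum_(i < s) n i.

Definition addu n j : index s := [ffun i => n i + (i == j)].

(* Truncated at 0; only meaningful when [0 < n j]. *)
Definition subu n j : index s := [ffun i => n i - (i == j)].

(* An element of N \cup {oo} is an [option nat], where [None] stands for oo. *)
Definition in_box (M : 'I_s -> option nat) n : Prop :=
  forall j, if M j is Some Mj then n j <= Mj else true.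

Definition box_subu (M : 'I_s -> option nat) j : 'I_s -> option nat :=
  fun i => if i == j then omap predn (M i) else M i.

(* [n = M]; in particular all the M_j are finite. *)
Definition is_corner (M : 'I_s -> option nat) n : Prop :=
  forall j, M j = Some (n j).

End Index.

(* [ord_max : 'I_s.+1] is the last component, and [lift ord_max j], whose value
   is that of [j : 'I_s], is the j-th of the first s components. *)
Definition butlast (T : Type) (s : nat) (f : 'I_s.+1 -> T) : 'I_s -> T :=
  fun j => f (lift ord_max j).

Definition extend (s : nat) (k : index s) (m : nat) : index s.+1 :=
  [ffun i => if unlift ord_max i is Some j then k j else m].

Section Moments.
Variable F : fieldType.
Implicit Type mu : {scalar {poly F}}.

Definition hankel_det mu (n : nat) : F :=
  \det (\matrix_(i < n, k < n) mu 'X^(i + k)).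

Definition in_L (N : option nat) mu : Prop :=
  if N is Some N0 then
    [/\ (0 < N0)%N,
        forall n, (1 <= n <= N0)%N -> hankel_det mu n != 0
      & forall n, (N0 < n)%N -> hankel_det mu n = 0]
  else forall n, hankel_det mu n != 0.

Definition is_monic_orthopoly mu (m : nat) (P : {poly F}) : Prop :=
  [/\ P \is monic, size P = m.+1
    & forall p, (p < m)%N -> mu (P * 'X^p) = 0].

Definition mulfun (Phi : {poly F}) mu : {poly F} -> F :=
  fun f => mu (Phi * f).

Lemma mulfun_is_scalar (Phi : {poly F}) mu : scalar (mulfun Phi mu).
Proof. by move=> c f g; rewrite /mulfun mulrDr -scalerAr linearP. Qed.

HB.instance Definition _ (Phi : {poly F}) mu :=
  GRing.isLinear.Build F {poly F} F *%R (mulfun Phi mu)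
    (mulfun_is_scalar Phi mu).

Definition mulsys (s : nat) (Phi : {poly F}) (mu : 'I_s -> {scalar {poly F}})
  : 'I_s -> {scalar {poly F}} := fun j => mulfun Phi (mu j).

Section System.
Variables (s : nat) (mu : 'I_s -> {scalar {poly F}}).

Definition typeII (n : index s) (P : {poly F}) : Prop :=
  [/\ P != 0, (size P <= (norm1 n).+1)%N
    & forall j p, (p < n j)%N -> mu j (P * 'X^p) = 0].

Definition normal (n : index s) : Prop :=
  forall P, typeII n P -> size P = (norm1 n).+1.

(* At a normal index [P n] is the unique monic type II polynomial; at the other
   indices it is an arbitrary type II polynomial. *)
Definition typeII_family (P : index s -> {poly F}) : Prop :=
  forall n, typeII n (P n) /\ (normal n -> P n \is monic).

(* The nearest neighbour recurrence determines [b n j] when [n] and [addu n j]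
   are normal, and [a n i] when [n] and some [addu n l] are; other values are
   unspecified, except that [a] vanishes at the corner of the box [N]. *)
Definition nn_coefficients (N : 'I_s -> option nat) (P : index s -> {poly F})
    (a b : index s -> 'I_s -> F) : Prop :=
  [/\ typeII_family P,
      forall n j, normal n -> normal (addu n j) ->
        (forall i, n i = 0%N -> a n i = 0) /\
        'X * P n = P (addu n j) + b n j *: P n
                   + \sum_(i < s) a n i *: P (subu n i)
    & forall n, is_corner N n -> forall j, a n j = 0].

Definition a_defined (N : 'I_s -> option nat) (n : index s) : Prop :=
  (normal n /\ exists l, normal (addu n l)) \/ is_corner N n.

Definition perfect (K : 'I_s -> option nat) : Prop :=
  forall k, in_box K k -> normal k.

End System.
End Moments.

(* Main.v *)
(** Since [Delta_n = 0] for [n > m], the functional [mu_r] kills every multiple of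
    [Phi], and conversely a polynomial that is [mu_r]-orthogonal to
    [1, ..., x^(m-1)] is a multiple of [Phi]. Hence [Q |-> Phi * Q] is a bijection
    from the type II polynomials of nuhat at [k] onto those of [mu] at [(k, m)],
    and [P_(k,m) = Phi * Phat_k]. Both kinds of coefficients are determined by the
    recurrence: [a_(n,i)] is obtained by applying [mu_i] to the recurrence times
    [x^(n_i - 1)], and [b_(n,j)] is the only scalar for which
    [x P_n - P_(n+e_j) - b P_n] has degree less than [|n|]. *)

Require Import Defs.
From mathcomp Require Import ring.

Set Implicit Arguments.
Unset Strict Implicit.
Unset Printing Implicit Defensive.

Import GRing.Theory.
Local Open Scope ring_scope.
Local Open Scope complex_scope.

(** * Moment functionals, Hankel determinants and functionals of finite rank *)

Section Functional.
Variable F : fieldType.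
Implicit Types (mu : {scalar {poly F}}) (B Q f : {poly F}).

Lemma functional_mul_sum mu Q f :
  mu (Q * f) = \sum_(i < size f) f`_i * mu (Q * 'X^i).
Proof.
rewrite -{1}[f]coefK poly_def mulr_sumr linear_sum; apply: eq_bigr => i _.
by rewrite -scalerAr linearZ.
Qed.

Lemma functional_mul_eq0 mu n Q f :
  (forall p, (p < n)%N -> mu (Q * 'X^p) = 0) -> (size f <= n)%N ->
  mu (Q * f) = 0.
Proof.
move=> orthQ szf; rewrite functional_mul_sum big1 // => i _.
by rewrite orthQ ?mulr0 // (leq_trans _ szf).
Qed.

(** A row vector in the kernel of the Hankel matrix is the coefficient vector of such a [Q]: its
    product with column [k] is [mu (Q * 'X^k)]. *)
Lemma hankel_det_eq0P mu n :
  reflect (exists Q, [/\ Q != 0, (size Q <= n)%N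
                       & forall p, (p < n)%N -> mu (Q * 'X^p) = 0])
          (hankel_det mu n == 0).
Proof.
pose H := \matrix_(i < n, k < n) mu 'X^(i + k).
have HE (v : 'rV[F]_n) (k : 'I_n) : (v *m H) 0 k = mu (rVpoly v * 'X^k).
  rewrite mxE /rVpoly poly_def mulr_suml linear_sum; apply: eq_bigr => i _.
  by rewrite mxE valK -scalerAl linearZ -exprD.
rewrite /hankel_det -/H; apply: (iffP det0P) => [[v v0 vH]|[Q [Q0 szQ orthQ]]].
  exists (rVpoly v); split; last first.
  - by move=> p pn; rewrite -(HE v (Ordinal pn)) vH mxE.
  - by rewrite size_poly.
  by apply: contra_neq v0 => v0; rewrite -[v]rVpolyK v0 linear0.
exists (poly_rV Q).
  by apply: contra_neq Q0 => Q0; rewrite -(poly_rV_K szQ) Q0 linear0.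
by apply/rowP=> k; rewrite HE poly_rV_K // orthQ // mxE.
Qed.

Section FiniteRank.
Variables (mu : {scalar {poly F}}) (m : nat) (Phi : {poly F}).
Hypotheses (Lmu : in_L (Some m) mu) (oPhi : is_monic_orthopoly mu m Phi).

(** A nonzero [B] would give a kernel vector of the invertible Hankel matrix of size [m]. *)
Lemma in_L_orthogonal_eq0 B :
  (size B <= m)%N -> (forall p, (p < m)%N -> mu (B * 'X^p) = 0) -> B = 0.
Proof.
move=> szB orthB; case: Lmu => m0 /(_ m); rewrite m0 leqnn => /(_ isT) H _.
by apply: contraNeq H => B0; apply/hankel_det_eq0P; exists B.
Qed.

Lemma orthopoly_neq0 : Phi != 0.
Proof. by case: oPhi => /monic_neq0. Qed.

Lemma size_modp_orthopoly Q : (size (Q %% Phi)%R <= m)%N.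
Proof.
by have := ltn_modp Q Phi; rewrite orthopoly_neq0; case: oPhi => _ -> _.
Qed.

(* If [Phi x^(m+k)] were the first moment that does not vanish, then the kernel
   of the singular Hankel matrix of size [m+k+1] would consist of multiples
   [A Phi], and [mu (A Phi x^(m+k-deg A)) != 0]. *)
Lemma orthopoly_annihilates f : mu (Phi * f) = 0.
Proof.
suff orth n p : (p < n)%N -> mu (Phi * 'X^p) = 0.
  exact: (functional_mul_eq0 (n := size f)) (orth _) _.
elim: n p => // n IHn p; rewrite ltnS leq_eqVlt => /predU1P[-> {p}|/IHn//].
case: (ltnP n m) => [|mn]; first by case: oPhi => _ _; apply.
have /eqP/hankel_det_eq0P[Q [Q0 szQ orthQ]] : hankel_det mu n.+1 = 0.
  by case: Lmu => _ _; apply.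
case: oPhi => monPhi szPhi _.
pose A : {poly F} := Q %/ Phi.
have szA : (size A <= (n - m).+1)%N.
  by rewrite size_divp ?orthopoly_neq0 // szPhi /= -subSn // leq_sub2r.
(* For [p < m] the polynomial [A * 'X^p] has size at most [n], so [mu (A * Phi * 'X^p)] vanishes by
   induction and the remainder inherits the orthogonality of [Q]. *)
have modQ0 : Q %% Phi = 0.
  apply: in_L_orthogonal_eq0 (size_modp_orthopoly Q) _ => p pm.
  have -> : Q %% Phi = Q - A * Phi by rewrite {2}(divp_eq Q Phi) addrC addKr.
  rewrite mulrBl linearB /= orthQ ?(leq_trans pm) ?leqW // sub0r -mulrA mulrCA.
  rewrite (functional_mul_eq0 (n := n)) ?oppr0 // (leq_trans (size_polyMleq _ _)) //.
  rewrite size_polyXn addnS /= (leq_trans (leq_add szA (leqnn p))) //.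
  by rewrite addSnnS -[leqRHS](subnK mn) leq_add2l.
have QE : Q = A * Phi by rewrite {1}(divp_eq Q Phi) modQ0 addr0.
have A0 : A != 0 by apply: contra_neq Q0; rewrite QE => ->; rewrite mul0r.
pose d := (size A).-1.
have dn : (d <= n)%N.
  by rewrite -ltnS prednK ?size_poly_gt0 // (leq_trans szA) // ltnS leq_subr.
have szAX : size (A * 'X^(n - d)) = n.+1.
  rewrite size_Mmonic ?monicXn // size_polyXn addnS /=.
  by rewrite -[size A]prednK ?size_poly_gt0 // addSn subnKC.
(* [A * 'X^(n - d)] has degree exactly [n], so by induction only its leading term survives, which
   forces [mu (Phi * 'X^n) = 0]. *)
have := orthQ (n - d)%N; rewrite ltnS leq_subr => /(_ isT).
rewrite QE mulrAC mulrC [mu (_ * (A * _))]functional_mul_sum szAX.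
rewrite big_ord_recr /= big1 => [|i _].
  move/eqP; rewrite add0r mulf_eq0 => /orP[|/eqP//].
  have -> : (A * 'X^(n - d))`_n = lead_coef (A * 'X^(n - d)).
    by rewrite lead_coefE szAX.
  by rewrite lead_coef_eq0 -size_poly_eq0 szAX.
by rewrite IHn ?mulr0.
Qed.

(** Since [mu] kills multiples of [Phi], the remainder of [Q] is as orthogonal as [Q], and its size
    is at most [m]. *)
Lemma orthopoly_dvdp Q :
  (forall p, (p < m)%N -> mu (Q * 'X^p) = 0) -> Phi %| Q.
Proof.
move=> orthQ; apply/modp_eq0P.
apply: in_L_orthogonal_eq0 (size_modp_orthopoly Q) _ => p pm.
have -> : Q %% Phi = Q - Q %/ Phi * Phi by rewrite {2}(divp_eq Q Phi) addrC addKr.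
by rewrite mulrBl linearB /= orthQ // mulrAC mulrC orthopoly_annihilates subr0.
Qed.

End FiniteRank.
End Functional.

(** * Multi-indices and boxes *)

Section Index.
Local Open Scope nat_scope.
Variable s : nat.
Implicit Types n k : index s.

Lemma norm1_addu n j : norm1 (addu n j) = (norm1 n).+1.
Proof.
rewrite /norm1 (eq_bigr (fun i => n i + (i == j))) => [|i _]; last by rewrite ffunE.
rewrite big_split /= -addn1; congr addn; rewrite (bigD1 j) //= eqxx.
by rewrite big1 // => i /negPf->.
Qed.

Lemma addu_subu n j : 0 < n j -> addu (subu n j) j = n.
Proof.
move=> nj; apply/ffunP => i; rewrite !ffunE.
by case: eqP => [->|_]; rewrite ?subnK ?subn0 ?addn0.
Qed.

Lemma norm1_subu n j : 0 < n j -> (norm1 (subu n j)).+1 = norm1 n.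
Proof. by move=> nj; rewrite -(norm1_addu _ j) addu_subu. Qed.

Lemma extend_lift k m j : extend k m (lift ord_max j) = k j.
Proof. by rewrite ffunE liftK. Qed.

Lemma extend_max k m : extend k m ord_max = m.
Proof. by rewrite ffunE unlift_none. Qed.

Lemma norm1_extend k m : norm1 (extend k m) = norm1 k + m.
Proof.
rewrite /norm1 big_ord_recr /= extend_max; congr (_ + _); apply: eq_bigr => i _.
rewrite -(extend_lift k m); congr (extend k m _); apply: val_inj.
by rewrite /= /bump leqNgt ltn_ord.
Qed.

Lemma addu_extend k m j :
  addu (extend k m) (lift ord_max j) = extend (addu k j) m.
Proof.
apply/ffunP => i; case: (unliftP ord_max i) => [i'|] ->.
  by rewrite ffunE !extend_lift ffunE (inj_eq lift_inj).
by rewrite ffunE !extend_max (negPf (neq_lift _ _)) addn0.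
Qed.

Lemma subu_extend k m j :
  subu (extend k m) (lift ord_max j) = extend (subu k j) m.
Proof.
apply/ffunP => i; case: (unliftP ord_max i) => [i'|] ->.
  by rewrite ffunE !extend_lift ffunE (inj_eq lift_inj).
by rewrite ffunE !extend_max (negPf (neq_lift _ _)) subn0.
Qed.

Lemma in_box_subu K k j : in_box K k -> in_box K (subu k j).
Proof.
move=> Kk i; have := Kk i; case: (K i) => // Ki; rewrite ffunE.
by apply: leq_trans; rewrite leq_subr.
Qed.

Lemma in_box_addu K k j :
  in_box K k -> (if K j is Some Kj then k j < Kj else true) ->
  in_box K (addu k j).
Proof.
move=> Kk Kkj i; have := Kk i; rewrite ffunE; case: (eqVneq i j) => [->|_].
  by rewrite addn1; case: (K j) Kkj.
by rewrite addn0.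
Qed.

(** [K j = Some 0] is excluded because [predn 0 = 0]: the reduced box would then equal [K], and
    [addu k j] would leave it. *)
Lemma in_box_box_subu K k j :
  K j != Some 0 -> in_box (box_subu K j) k ->
  in_box K k /\ in_box K (addu k j).
Proof.
move=> K0 Kk; have Kk' : in_box K k.
  move=> i; have := Kk i; rewrite /box_subu; case: eqP => // _.
  by case: (K i) => //= Ki kKi; rewrite (leq_trans kKi) ?leq_pred.
split=> //; apply: in_box_addu => //.
by have := Kk j; rewrite /box_subu eqxx; case: (K j) K0 => [[|Kj]|].
Qed.

(** These are the two ways in which [a] is determined at [k] for a perfect system: by a normal
    neighbour, or by the convention at the corner. *)
Lemma in_box_corner_or_addu K k :
  in_box K k -> is_corner K k \/ exists l, in_box K (addu k l).
Proof.
move=> Kk; case: (pickP (fun l => if K l is Some Kl then k l < Kl else true)).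
  by move=> l Kl; right; exists l; apply: in_box_addu.
move=> maxk; left => j; have := maxk j; have := Kk j.
case: (K j) => // Kj kKj; rewrite ltnNge => /negbFE Kjk.
by congr Some; apply/eqP; rewrite eqn_leq kKj Kjk.
Qed.

Lemma is_corner_extend (N : 'I_s.+1 -> option nat) k m :
  N ord_max = Some m -> is_corner (butlast N) k -> is_corner N (extend k m).
Proof.
move=> Nm Nk j; case: (unliftP ord_max j) => [j'|] ->.
  by rewrite extend_lift; apply: Nk.
by rewrite extend_max.
Qed.

End Index.

(** * Type II polynomials and recurrence coefficients of a general system *)

Section Coefficients.
Variables (F : fieldType) (s : nat) (mu : 'I_s -> {scalar {poly F}}).
Implicit Types (n : index s) (j : 'I_s) (P Q : {poly F}).

Lemma typeII_le_orth n n' P j p :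
  typeII mu n P -> (n' j <= n j)%N -> (p < n' j)%N -> mu j (P * 'X^p) = 0.
Proof. by case=> _ _ orthP nn' pn'; rewrite orthP // (leq_trans pn'). Qed.

(** A nonzero difference would again be of type II at [n], but the leading terms cancel, against
    normality. *)
Lemma typeII_normal_monic_unique n P Q :
  normal mu n -> typeII mu n P -> typeII mu n Q ->
  P \is monic -> Q \is monic -> P = Q.
Proof.
move=> nn tP tQ mP mQ; apply/eqP; rewrite -subr_eq0; apply/negPn/negP => PQ0.
have szP := nn _ tP; have szQ := nn _ tQ.
have szPQ : (size (P - Q)%R <= (norm1 n).+1)%N.
  by rewrite (leq_trans (size_polyD _ _)) // size_polyN szP szQ maxnn.
have tPQ : typeII mu n (P - Q).
  split=> // j p pn; case: tP tQ => _ _ oP [_ _ oQ].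
  by rewrite mulrBl linearB /= oP // oQ // subrr.
have := nn _ tPQ; apply/eqP; rewrite neq_ltn ltnS; apply/orP; left.
apply/leq_sizeP => i; rewrite leq_eqVlt => /predU1P[<-|ni].
  move/monicP: mP; rewrite lead_coefE szP /= => P1.
  by move/monicP: mQ; rewrite lead_coefE szQ /= => Q1; rewrite coefB P1 Q1 subrr.
by rewrite (leq_sizeP _ _ szPQ).
Qed.

(** Otherwise [P], whose degree is too small, would be of type II at the normal index [n]. This
    allows division by the factor of [a n i] in [nn_a_moment]. *)
Lemma typeII_subu_moment_neq0 n P i :
  normal mu n -> (0 < n i)%N -> typeII mu (subu n i) P ->
  mu i (P * 'X^((n i).-1)) != 0.
Proof.
move=> nn ni [P0 szP orthP]; apply/eqP => P_0.
move: (szP); rewrite norm1_subu // leqNgt (nn P) ?ltnSn //; split=> //.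
  by move: szP; rewrite norm1_subu // => /leqW.
move=> j p pn; case: (eqVneq j i) => [ji|ji]; last first.
  by apply: orthP; rewrite ffunE (negPf ji) subn0.
move: pn; rewrite {}ji -{1}(prednK ni) ltnS leq_eqVlt => /predU1P[->//|pn].
by apply: orthP; rewrite ffunE eqxx subn1.
Qed.

Variables (N : 'I_s -> option nat) (P : index s -> {poly F}).
Variables (a b : index s -> 'I_s -> F).
Hypothesis nnc : nn_coefficients mu N P a b.

Lemma nn_typeII n : typeII mu n (P n).
Proof. by case: nnc => /(_ n)[]. Qed.

Lemma nn_monic n : normal mu n -> P n \is monic.
Proof. by case: nnc => /(_ n)[]. Qed.

Lemma nn_a_moment n j i : normal mu n -> normal mu (addu n j) -> (0 < n i)%N ->
  mu i (P n * 'X^(n i)) = a n i * mu i (P (subu n i) * 'X^((n i).-1)).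
Proof.
move=> nn nnj ni; case: nnc => _ /(_ n j nn nnj)[_ rec] _.
have lt_ni : ((n i).-1 < n i)%N by rewrite ltn_predL.
have -> : P n * 'X^(n i) = 'X * P n * 'X^((n i).-1).
  by rewrite -{1}(prednK ni) exprS mulrA [P n * _]mulrC.
(* At exponent [(n i).-1], [mu i] kills the terms at [addu n j], at [n] and at [subu n l] for
   [l != i]; only the term at [subu n i] remains. *)
rewrite rec 2!mulrDl mulr_suml !linearD linear_sum /=.
rewrite (typeII_le_orth (nn_typeII (addu n j)) (n' := n)) ?ffunE ?leq_addr //.
rewrite -scalerAl linearZ /= (typeII_le_orth (nn_typeII n) (n' := n)) //.
rewrite mulr0 !add0r (bigD1 i) //= -scalerAl linearZ big1 ?addr0 // => l li.
rewrite -scalerAl linearZ /=.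
rewrite (typeII_le_orth (nn_typeII (subu n l)) (n' := n)) ?mulr0 //.
by rewrite ffunE eq_sym (negPf li) subn0.
Qed.

Lemma nn_a_eq0 n j i : normal mu n -> normal mu (addu n j) -> n i = 0%N ->
  a n i = 0.
Proof. by move=> nn nnj; case: nnc => _ /(_ n j nn nnj)[H _] _; apply: H. Qed.

Lemma nn_a_corner n j : is_corner N n -> a n j = 0.
Proof. by case: nnc => _ _ H /H. Qed.

Lemma nn_b_size n j : normal mu n -> normal mu (addu n j) ->
  (size ('X * P n - P (addu n j) - b n j *: P n)%R <= norm1 n)%N.
Proof.
move=> nn nnj; case: nnc => _ /(_ n j nn nnj)[a0 ->] _.
rewrite -addrA -opprD addrAC subrr add0r.
apply: (leq_trans (size_sum _ _ _)); apply/bigmax_leqP => i _.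
(* If [n i = 0], the truncated [subu n i] is [n] itself and [P n] is too large, but its coefficient
   is 0. *)
case: (posnP (n i)) => [/a0->|ni]; first by rewrite scale0r size_poly0.
rewrite (leq_trans (size_scale_leq _ _)) //.
by case: (nn_typeII (subu n i)) => _; rewrite norm1_subu.
Qed.

End Coefficients.

(** * Transfer between [mu] at [extend k m] and [nuhat] at [k] *)

Section Reduction.
Variables (F : fieldType) (s : nat) (mu : 'I_s.+1 -> {scalar {poly F}}).
Variables (m : nat) (Phi : {poly F}).
Hypotheses (Lmu : in_L (Some m) (mu ord_max)).
Hypothesis (oPhi : is_monic_orthopoly (mu ord_max) m Phi).
Let nuhat := mulsys Phi (butlast mu).
Implicit Types (k : index s) (Q : {poly F}).

Lemma typeII_extend_dvdp k Q : typeII mu (extend k m) Q -> Phi %| Q.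
Proof.
case=> _ _ oQ; apply: (orthopoly_dvdp Lmu oPhi) => p pm.
by apply: oQ; rewrite extend_max.
Qed.

Lemma size_mul_orthopoly Q : Q != 0 -> size (Phi * Q) = (size Q + m)%N.
Proof.
case: oPhi => monPhi szPhi _ Q0.
by rewrite size_monicM // szPhi addSn /= addnC.
Qed.

(** Degrees shift by [m], the conditions for the first [s] functionals agree by associativity, and
    the last functional kills every multiple of [Phi]. *)
Lemma typeII_extend k Q :
  typeII mu (extend k m) (Phi * Q) <-> typeII nuhat k Q.
Proof.
have Phi0 := orthopoly_neq0 oPhi.
split=> -[Q0 szQ oQ].
  move: Q0; rewrite mulf_eq0 negb_or => /andP[_ Q0].
  rewrite size_mul_orthopoly // norm1_extend -addSn leq_add2r in szQ.
  split=> //.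
  move=> j p pk; rewrite /nuhat /mulsys /= /mulfun mulrA.
  by apply: oQ; rewrite extend_lift.
split; first by rewrite mulf_neq0.
  by rewrite size_mul_orthopoly // norm1_extend -addSn leq_add2r.
move=> j p; case: (unliftP ord_max j) => [j'|] ->.
  by rewrite extend_lift => /oQ; rewrite /nuhat /mulsys /= /mulfun mulrA.
by rewrite -mulrA (orthopoly_annihilates Lmu oPhi).
Qed.

Lemma normal_extend k : normal mu (extend k m) <-> normal nuhat k.
Proof.
split=> nk Q.
  move=> tQ; case: (tQ) => Q0 _ _; have /nk := (typeII_extend k Q).2 tQ.
  by rewrite size_mul_orthopoly // norm1_extend -addSn => /addIn.
move=> tQ; have /dvdpP[A QE] := typeII_extend_dvdp tQ.
move: tQ; rewrite QE mulrC => /typeII_extend tA; case: (tA) => A0 _ _.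
by rewrite size_mul_orthopoly // nk // norm1_extend addSn.
Qed.

Lemma typeII_extend_monicE k Q Qhat :
  normal nuhat k -> typeII mu (extend k m) Q -> Q \is monic ->
  typeII nuhat k Qhat -> Qhat \is monic -> Q = Phi * Qhat.
Proof.
move=> /normal_extend nk tQ mQ /typeII_extend tQhat mQhat.
apply: typeII_normal_monic_unique tQ tQhat mQ _ => //.
by rewrite monicMr //; case: oPhi.
Qed.

Variables (N : 'I_s.+1 -> option nat) (P : index s.+1 -> {poly F}).
Variables (a b : index s.+1 -> 'I_s.+1 -> F).
Hypothesis nnc : nn_coefficients mu N P a b.

(** In the moment formula for [a], the left side is a moment of a multiple of [Phi], hence 0, while
    the factor of [a] is nonzero. *)
Lemma a_extend_max_eq0 k :
  a_defined mu N (extend k m) -> a (extend k m) ord_max = 0.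
Proof.
case=> [[nk [l nkl]]|]; last exact: nn_a_corner nnc _ _.
have m0 : (0 < extend k m ord_max)%N by rewrite extend_max; case: Lmu.
have := nn_a_moment nnc nk nkl m0.
have /dvdpP[A ->] := typeII_extend_dvdp (nn_typeII nnc (extend k m)).
rewrite mulrAC mulrC (orthopoly_annihilates Lmu oPhi) => /esym/eqP.
rewrite mulf_eq0 => /orP[/eqP//|].
by rewrite (negPf (typeII_subu_moment_neq0 nk m0 (nn_typeII nnc _))).
Qed.

Variables (Phat : index s -> {poly F}) (ahat bhat : index s -> 'I_s -> F).
Hypothesis nnchat : nn_coefficients nuhat (butlast N) Phat ahat bhat.

Lemma nn_extendE k : normal nuhat k -> P (extend k m) = Phi * Phat k.
Proof.
move=> nk; apply: (typeII_extend_monicE nk).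
- exact: nn_typeII nnc _.
- by apply: (nn_monic nnc); apply/normal_extend.
- exact: nn_typeII nnchat _.
- exact: (nn_monic nnchat).
Qed.

(** Both coefficients solve the same moment equation. Normality of [subu k j] identifies [P] there
    with [Phi * Phat]; at other indices the two families are chosen independently. *)
Lemma a_extend_lift k j l :
  normal nuhat k -> normal nuhat (addu k l) ->
  ((0 < k j)%N -> normal nuhat (subu k j)) ->
  a (extend k m) (lift ord_max j) = ahat k j.
Proof.
move=> nk nkl nkj.
have nek := (normal_extend k).2 nk.
have nekl : normal mu (addu (extend k m) (lift ord_max l)).
  by rewrite addu_extend; apply/normal_extend.
case: (posnP (k j)) => [k0|k0].
  by rewrite (nn_a_eq0 nnc nek nekl) ?extend_lift // (nn_a_eq0 nnchat nk nkl).
have ek0 : (0 < extend k m (lift ord_max j))%N by rewrite extend_lift.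
have tsub := nn_typeII nnc (subu (extend k m) (lift ord_max j)).
apply: (mulIf (typeII_subu_moment_neq0 nek ek0 tsub)).
rewrite -(nn_a_moment nnc nek nekl ek0) subu_extend extend_lift.
(* Once [Phi] is moved to the front, the moments are those of [nuhat j] by conversion. *)
rewrite (nn_extendE nk) (nn_extendE (nkj k0)) -!mulrA.
exact: (nn_a_moment nnchat nk nkl k0).
Qed.

(** [Phi] times the remainder [X] for [nuhat], minus the remainder [Y] for [mu], is the difference
    of the [b]'s times [P (extend k m)]; its size is too small unless that difference is 0. *)
Lemma b_extend_lift k j :
  normal nuhat k -> normal nuhat (addu k j) ->
  b (extend k m) (lift ord_max j) = bhat k j.
Proof.
move=> nk nkj.
have nek := (normal_extend k).2 nk.
have nekj : normal mu (addu (extend k m) (lift ord_max j)).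
  by rewrite addu_extend; apply/normal_extend.
have := nn_b_size nnc nek nekj.
have := nn_b_size nnchat nk nkj.
rewrite addu_extend !nn_extendE // norm1_extend.
set X := _ - bhat k j *: _; set Y := _ - b _ _ *: _ => szX szY.
apply/eqP; rewrite -subr_eq0; apply/negPn/negP => c0.
have := nek _ (nn_typeII nnc (extend k m)); apply/eqP.
rewrite neq_ltn ltnS norm1_extend nn_extendE // -(size_scale _ c0).
apply/orP; left.
have -> : (b (extend k m) (lift ord_max j) - bhat k j) *: (Phi * Phat k)
          = Phi * X - Y.
  by rewrite /X /Y scalerBl mulrBr -scalerAr; ring.
rewrite (leq_trans (size_polyD _ _)) // size_polyN geq_max szY andbT.
case: (eqVneq X 0) => [->|X0]; first by rewrite mulr0 size_poly0.
by rewrite size_mul_orthopoly // leq_add2r.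
Qed.

End Reduction.

Theorem theorem3p5 (R : realType) (s : nat) (hs : (2 <= s.+1)%N)
  (mu : 'I_s.+1 -> {scalar {poly R[i]}}) (N : 'I_s.+1 -> option nat) (m : nat)
  (hmu : forall j, in_L (N j) (mu j)) (hm : N ord_max = Some m)
  (Phi : {poly R[i]}) (hPhi : is_monic_orthopoly (mu ord_max) m Phi)
  (P : index s.+1 -> {poly R[i]}) (a b : index s.+1 -> 'I_s.+1 -> R[i])
  (hab : nn_coefficients mu N P a b)
  (Phat : index s -> {poly R[i]}) (ahat bhat : index s -> 'I_s -> R[i])
  (habhat : nn_coefficients (mulsys Phi (butlast mu)) (butlast N)
              Phat ahat bhat) :
  let nu := butlast mu in
  let K := butlast N in
  let nuhat := mulsys Phi nu in
  (forall k : index s, in_box K k -> a_defined mu N (extend k m) ->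
     a (extend k m) ord_max = 0)
  /\
  (perfect nu K -> perfect nuhat K ->
   forall j : 'I_s,
     (forall k : index s, in_box K k ->
        a (extend k m) (lift ord_max j) = ahat k j)
     /\
     (forall k : index s, in_box (box_subu K j) k ->
        b (extend k m) (lift ord_max j) = bhat k j)).
Proof.
move=> nu K nuhat.
have Lr : in_L (Some m) (mu ord_max) by rewrite -hm.
split=> [k _|_ perfhat j]; first exact: (a_extend_max_eq0 Lr hPhi hab).
split=> k Kk.
  have nk := perfhat _ Kk.
  case: (in_box_corner_or_addu Kk) => [ck|[l Kkl]].
    rewrite (nn_a_corner habhat) // (nn_a_corner hab) //.
    exact: is_corner_extend.
  apply: (a_extend_lift Lr hPhi hab habhat nk (perfhat _ Kkl)) => _.
  exact/perfhat/in_box_subu.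
(* Membership in [in_L] forces a finite [N j] to be positive. *)
have K0 : K j != Some 0%N.
  have := hmu (lift ord_max j); rewrite /K /butlast.
  by case: (N _) => [[|Nj]|] // [].
have [Kk' Kkj] := in_box_box_subu K0 Kk.
exact: (b_extend_lift Lr hPhi hab habhat (perfhat _ Kk') (perfhat _ Kkj)).
Qed.
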